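(* Let $T>0$, let $n,m\ge 1$ be integers, and let $G,A_1,\dots,A_m:[0,T]\to M_n(\mathbb{C})$. Let $U(t)=\mathcal{T}\exp\left(\int_0^t dt_1\,G(t_1)\right)$. Let $L(t)$ be the $(m+1)\times(m+1)$ block matrix with $n\times n$ blocks whose diagonal blocks are all $G(t)$, whose first upper off-diagonal is $(A_1(t),\dots,A_m(t))$ (that is, the $(i,i+1)$ block is $A_i(t)$ for $1\le i\le m$), and whose other blocks are all $0$. Then for all $t\in[0,T]$ the time-ordered exponential $\mathcal{T}\exp\left(\int_0^t dt_1\,L(t_1)\right)$ is block upper triangular, all of its diagonal blocks are $U(t)$, and for $1\le i<j\le m+1$ its $(i,j)$ block is $\mathcal{D}_U(A_i,\dots,A_{j-1})(t)$. In particular its top right block is $\mathcal{D}_U(A_1,\dots,A_m)(t)$.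
   Context: $M_n(\mathbb{C})$ is the set of $n\times n$ complex matrices and $\mathbb{1}_N$ is the $N\times N$ identity matrix. For $G:[0,T]\to M_N(\mathbb{C})$, the time-ordered exponential $\mathcal{T}\exp\left(\int_0^t dt_1\,G(t_1)\right)$ is notation for the value at $t$ of the unique solution $U$ of the initial value problem $\dot U(t)=G(t)U(t)$, $U(0)=\mathbb{1}_N$ on $[0,T]$. For matrix-valued functions $A_1,\dots,A_k:[0,T]\to M_n(\mathbb{C})$, $$\mathcal{D}_U(A_1,\dots,A_k)(t)=U(t)\int_0^t dt_1\int_0^{t_1}dt_2\cdots\int_0^{t_{k-1}}dt_k\;U^{-1}(t_1)A_1(t_1)U(t_1)\cdots U^{-1}(t_k)A_k(t_k)U(t_k).$$ Standing assumption: all generators are regular enough that the relevant initial value problems have unique solutions and the integrals make sense (e.g. piecewise continuous on $[0,T]$). *)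

(* Defs.v *)
(* The complex numbers are R[i], for an arbitrary R : realType. *)
From HB Require Import structures.
From mathcomp Require Import all_boot all_order all_algebra.
From mathcomp Require Import complex.
From mathcomp Require Import all_classical all_reals all_analysis.

Set Implicit Arguments.
Unset Strict Implicit.
Unset Printing Implicit Defensive.

Import Order.TTheory GRing.Theory Num.Theory.
Import numFieldNormedType.Exports.

Local Open Scope classical_set_scope.
Local Open Scope ring_scope.

(* R[i] carries no canonical topology, so the analysis of matrix-valued
   functions is done on the real and imaginary parts of their entries. *)
Definition entry_Re (R : realType) (p q : nat) (F : R -> 'M[R[i]]_(p, q))
    (i : 'I_p) (j : 'I_q) : R -> R :=
  fun t => complex.Re (F t i j).

Definition entry_Im (R : realType) (p q : nat) (F : R -> 'M[R[i]]_(p, q))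
    (i : 'I_p) (j : 'I_q) : R -> R :=
  fun t => complex.Im (F t i j).

(* Continuous in ]0, T[ off the finite set D, with all finite one-sided limits
   on [0, T]; values of f outside [0, T] are irrelevant. *)
Definition piecewise_continuous (R : realType) (T : R) (f : R -> R) : Prop :=
  exists D : seq R,
    [/\ forall t, 0 < t < T -> t \notin D -> {for t, continuous f},
        forall t, 0 <= t < T -> cvg (f x @[x --> t^'+])
      & forall t, 0 < t <= T -> cvg (f x @[x --> t^'-])].

Definition mx_piecewise_continuous (R : realType) (T : R) (p q : nat)
    (F : R -> 'M[R[i]]_(p, q)) : Prop :=
  forall i j, piecewise_continuous T (entry_Re F i j) /\
              piecewise_continuous T (entry_Im F i j).

Definition mx_continuous_at (R : realType) (p q : nat)
    (F : R -> 'M[R[i]]_(p, q)) (t : R) : Prop :=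
  forall i j, {for t, continuous (entry_Re F i j)} /\
              {for t, continuous (entry_Im F i j)}.

Definition mx_continuous_on (R : realType) (T : R) (p q : nat)
    (F : R -> 'M[R[i]]_(p, q)) : Prop :=
  forall i j, {within `[0, T], continuous (entry_Re F i j)} /\
              {within `[0, T], continuous (entry_Im F i j)}.

Definition mx_is_derive (R : realType) (p q : nat)
    (F : R -> 'M[R[i]]_(p, q)) (t : R) (dF : 'M[R[i]]_(p, q)) : Prop :=
  forall i j, is_derive t 1 (entry_Re F i j) (complex.Re (dF i j)) /\
              is_derive t 1 (entry_Im F i j) (complex.Im (dF i j)).

(* U' = G U, U(0) = 1 on [0, T].  As G may jump, the equation is required at
   the interior points where G is continuous and U is required to be continuous
   on all of [0, T]. *)
Definition is_ivp_solution (R : realType) (T : R) (N : nat)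
    (G U : R -> 'M[R[i]]_N) : Prop :=
  [/\ mx_continuous_on T U,
      U 0 = 1%:M
    & forall t, 0 < t < T -> mx_continuous_at G t ->
        mx_is_derive U t (G t *m U t)].

(* The solution is unique on [0, T] only: values outside are unspecified. *)
Definition time_ordered_exp (R : realType) (T : R) (N : nat)
    (G : R -> 'M[R[i]]_N) : R -> 'M[R[i]]_N :=
  xget (fun=> 1%:M) [set U | is_ivp_solution T G U].

Definition mx_integral (R : realType) (p q : nat) (a b : R)
    (F : R -> 'M[R[i]]_(p, q)) : 'M[R[i]]_(p, q) :=
  \matrix_(i, j)
    Complex (\int[lebesgue_measure]_(x in `[a, b]) entry_Re F i j x)
            (\int[lebesgue_measure]_(x in `[a, b]) entry_Im F i j x).

(* int_0^t dt_1 int_0^(t_1) dt_2 ... int_0^(t_(k-1)) dt_k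
     P * B_1(t_1) * ... * B_k(t_k)  for Bs = [:: B_1; ...; B_k];
   P accumulates the factors to the left. *)
Fixpoint iterated_integral (R : realType) (n : nat) (P : 'M[R[i]]_n)
    (Bs : seq (R -> 'M[R[i]]_n)) (t : R) {struct Bs} : 'M[R[i]]_n :=
  if Bs is B :: Bs' then
    mx_integral 0 t (fun s => iterated_integral (P *m B s) Bs' s)
  else P.

Definition DU (R : realType) (n : nat) (U : R -> 'M[R[i]]_n)
    (As : seq (R -> 'M[R[i]]_n)) (t : R) : 'M[R[i]]_n :=
  U t *m iterated_integral 1%:M
           [seq (fun s => invmx (U s) *m A s *m U s) | A <- As] t.

(* Indices start at 0: block (k, k.+1) is entry k of the tuple A. *)
Definition bidiagonal_generator (R : realType) (n m : nat)
    (G : R -> 'M[R[i]]_n) (A : m.-tuple (R -> 'M[R[i]]_n)) (t : R) :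
    'M[R[i]]_(\sum_(k < m.+1) n) :=
  \mxblock_(i < m.+1, j < m.+1)
    (if i == j then G t
     else if j == i.+1 :> nat then nth (fun=> 0) A i t
     else 0).

(* Main.v *)
(* The Picard series of a linear system with bounded measurable coefficients
   converges, and dominated convergence turns its sum into a solution, which is
   differentiable wherever the coefficients are continuous.  If Y solves the
   adjoint problem Y' = - Y G, Y(0) = 1, then (Y U)' = 0 off a finite set for
   every solution U, so Y U = 1: this gives at once the uniqueness of U and its
   inverse.  The blocks U * int_0^t (Y A_i U) * (iterated integral of A_(i+1),
   ...) satisfy W_(i,j)' = G W_(i,j) + A_i W_(i+1,j), which is the initial value
   problem for the bidiagonal generator, and uniqueness concludes. *)
Require Import Defs.
From HB Require Import structures.
From mathcomp Require Import all_boot all_order all_algebra.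
From mathcomp Require Import complex.
From mathcomp Require Import all_classical all_reals all_analysis.
From mathcomp Require Import measurable_realfun ring.

Set Implicit Arguments.
Unset Strict Implicit.
Unset Printing Implicit Defensive.

Import Order.TTheory GRing.Theory Num.Theory.
Import numFieldNormedType.Exports.

Local Open Scope classical_set_scope.
Local Open Scope ring_scope.

(** * Bounded measurable functions *)

(** Since the generators may jump, a solution need not be differentiable on all of []0, T[].
    Existence is therefore obtained from integral equations, with coefficients that are merely
    bounded and measurable: this class contains the piecewise continuous functions, is stable under
    sums and products, and consists of functions integrable on [[0, T]]. Derivatives come back
    afterwards, at points where the integrand is continuous, and a continuous function with zero
    derivative off a finite set is still constant. This is why the adjoint solution is so
    convenient: the product rule for [Y U] off the jumps replaces both a Gronwall estimate and the
    differentiation of [invmx (U s)]. For the block system the equation is demanded only where the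
    whole generator is continuous; there [G] and every [A_i] are continuous, since they occur as its
    blocks, so the explicit blocks can be differentiated at exactly those points. *)

Definition bounded_measurable (R : realType) (T : R) (f : R -> R) : Prop :=
  measurable_fun `[0, T] f /\
  exists M : R, forall x : R, 0 <= x <= T -> `|f x| <= M.

Lemma bounded_measurable_cst (R : realType) (T c : R) :
  bounded_measurable T (fun=> c).
Proof. by split=> //; exists `|c|. Qed.

Lemma bounded_measurableD (R : realType) (T : R) (f g : R -> R) :
  bounded_measurable T f -> bounded_measurable T g ->
  bounded_measurable T (f \+ g).
Proof.
move=> [mf [M Mf]] [mg [N Ng]]; split; first exact: measurable_funD.
exists (M + N) => x xT; apply: le_trans (ler_normD _ _) _.
by apply: lerD; [exact: Mf|exact: Ng].
Qed.

Lemma bounded_measurableM (R : realType) (T : R) (f g : R -> R) :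
  bounded_measurable T f -> bounded_measurable T g ->
  bounded_measurable T (f \* g).
Proof.
move=> [mf [M Mf]] [mg [N Ng]]; split; first exact: measurable_funM.
by exists (M * N) => x xT; rewrite normrM ler_pM ?Mf ?Ng.
Qed.

Lemma bounded_measurableN (R : realType) (T : R) (f : R -> R) :
  bounded_measurable T f -> bounded_measurable T (\- f).
Proof.
move=> [mf [M Mf]]; split; first exact: measurable_funN.
by exists M => x xT; rewrite normrN Mf.
Qed.

Lemma bounded_measurable_sum (R : realType) (T : R) (I : Type) (r : seq I)
    (f : I -> R -> R) :
  (forall i, bounded_measurable T (f i)) ->
  bounded_measurable T (fun x => \sum_(i <- r) f i x).
Proof.
move=> bf; elim: r => [|i r IH].
  by under eq_fun do rewrite big_nil; exact: bounded_measurable_cst.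
by under eq_fun do rewrite big_cons; exact: bounded_measurableD.
Qed.

Lemma within_continuous_bounded_measurable (R : realType) (T : R)
    (f : R -> R) :
  {within `[0, T], continuous f} -> bounded_measurable T f.
Proof.
move=> cf; split; first exact: subspace_continuous_measurable_fun.
have [M [_ Mf]] :=
  compact_bounded (continuous_compact cf (@segment_compact R 0 T)).
exists (M + 1) => x xT; apply: Mf; first by rewrite ltrDl.
by exists x => //=; rewrite in_itv.
Qed.

Lemma closed_seq (R : realType) (D : seq R) : closed [set` D].
Proof.
apply: compact_closed; first exact: Rhausdorff.
exact: finite_compact (finite_seq _).
Qed.

(** Singletons are measurable, so induction on the list applies; thus the values at the finitely
    many jumps cannot spoil measurability. *)
Lemma measurable_fun_seq (R : realType) (D : seq R) (f : R -> R) :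
  measurable_fun [set` D] f.
Proof.
elim: D => [|d D IH]; first by rewrite set_nil; exact: measurable_fun_set0.
have -> : [set` d :: D] = [set d] `|` [set` D].
  apply/seteqP; split=> x /=; rewrite inE.
    by case/predU1P; [left|right].
  by case=> [->|->]; rewrite ?eqxx ?orbT.
apply/measurable_funU => //; last by split=> //; exact: measurable_fun_set1.
by apply: closed_measurable; exact: closed_seq.
Qed.

(** Compactness of [[0, T]] in its near-covering form, with the filter [+oo] of candidate bounds as
    parameter: bounds valid near each point yield a single global one. Locally, the two one-sided
    limits bound [f] on either side of [x], and the value [f x] is added by hand. *)
Lemma piecewise_continuous_bounded (R : realType) (T : R) (f : R -> R) :
  piecewise_continuous T f ->
  exists M : R, forall x : R, 0 < x < T -> `|f x| <= M.
Proof.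
case=> D [_ fr fl].
have /compact_near_coveringP cov := @segment_compact R 0 T.
have [|M [_ HM]] := cov R +oo (fun M x => 0 < x < T -> `|f x| <= M) _.
  move=> x /=; rewrite in_itv /= => /andP[x0 xT].
  have bnd (F : set_system R) : ProperFilter F -> cvg (f @ F) ->
      \forall M \near +oo, \forall y \near F, `|f y| <= M.
    by move=> FF /cvg_ex[l fcl]; exact: cvg_bounded fcl.
  (* The guard [x < T] makes the claim vacuous at the right endpoint, where there is no right limit;
     [0 < x] plays the same role on the left. *)
  have [Mr [_ Hr]] : \forall M \near +oo, \forall y \near x,
      x < y -> x < T -> `|f y| <= M.
    have [xT'|xT'] := ltP x T; last by near=> M; near=> y.
    have /bnd : cvg (f y @[y --> x^'+]) by apply: fr; rewrite x0.
    by apply: filterS => M; apply: filterS => y bnd_y _.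
  have [Ml [_ Hl]] : \forall M \near +oo, \forall y \near x,
      y < x -> 0 < x -> `|f y| <= M.
    have [x0'|x0'] := ltP 0 x; last by near=> M; near=> y.
    have /bnd : cvg (f y @[y --> x^'-]) by apply: fl; rewrite x0'.
    by apply: filterS => M; apply: filterS => y bnd_y _.
  (* [Hr] and [Hl] apply strictly above the thresholds [Mr] and [Ml], hence the [+ 1]; the term with
     [f x] handles the case [y = x]. *)
  pose N := Num.max (Num.max (Mr + 1) (Ml + 1)) `|f x|.
  exists ([set y | (x < y -> x < T -> `|f y| <= N) /\ 
            (y < x -> 0 < x -> `|f y| <= N)], [set M | N < M]).
    split=> /=; last by exists N; split; rewrite ?num_real.
    have : \forall y \near x, x < y -> x < T -> `|f y| <= N.
      by apply: Hr; rewrite 2!lt_max ltrDl ltr01.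
    have : \forall y \near x, y < x -> 0 < x -> `|f y| <= N.
      by apply: Hl; rewrite 2!lt_max (ltrDl Ml) ltr01 orbT.
    by apply: filterS2 => y.
  case=> y M /= [[Hr' Hl'] NM] /andP[y0 yT]; apply: le_trans (ltW NM).
  have [yx|xy|->] := ltgtP y x.
  - by apply: Hl' => //; exact: lt_trans yx.
  - by apply: Hr' => //; exact: lt_trans yT.
  - by rewrite le_max lexx orbT.
exists (M + 1) => x x0T; apply: (HM (M + 1)) => //=; first by rewrite ltrDl.
by case/andP: x0T => x0 xT; rewrite in_itv /= !ltW.
Unshelve. all: by end_near. Qed.

Lemma piecewise_continuous_bounded_measurable (R : realType) (T : R)
    (f : R -> R) : 0 < T -> piecewise_continuous T f -> bounded_measurable T f.
Proof.
move=> T0 pf; split.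
  case: pf => D [fc _ _].
  (* With the endpoints among the exceptional points, the rest of [[0, T]] is an open set on which
     [f] is continuous. *)
  pose E := [:: 0, T & D].
  have oA : open (`]0, T[ `&` ~` [set` E]).
    apply: openI; first exact: interval_open.
    by apply: closed_openC; exact: closed_seq.
  apply: (@measurable_funS _ _ _ _ ((`]0, T[ `&` ~` [set` E]) `|` [set` E])).
  - apply: measurableU; first exact: open_measurable.
    by apply: closed_measurable; exact: closed_seq.
  - move=> x /=; rewrite in_itv /= => /andP[x0 xT].
    have [xE|xE] := boolP (x \in E); [by right|left; split=> //].
      rewrite /= in_itv /= !lt_neqAle x0 xT !andbT.
      by move: xE; rewrite !inE !negb_or eq_sym => /and3P[-> -> _].
  apply/measurable_funU.
  - exact: open_measurable.
  - by apply: closed_measurable; exact: closed_seq.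
  split; last exact: measurable_fun_seq.
  apply: open_continuous_measurable_fun => // x /set_mem [/= xT xE].
  apply: fc; first by rewrite in_itv in xT.
  by apply: contra_notN xE => xD; rewrite !inE xD !orbT.
have [M HM] := piecewise_continuous_bounded pf.
exists (Num.max M (Num.max `|f 0| `|f T|)) => x /andP[x0 xT].
rewrite !le_max; have [->|x0'] := eqVneq x 0; first by rewrite lexx orbT.
have [->|xT'] := eqVneq x T; first by rewrite lexx !orbT.
by rewrite HM // !lt_neqAle x0 xT xT' eq_sym x0'.
Qed.

(** * Primitives *)

Lemma bounded_measurable_integrable (R : realType) (T t : R) (f : R -> R) :
  t <= T -> bounded_measurable T f ->
  lebesgue_measure.-integrable `[0, t] (EFin \o f).
Proof.
move=> tT [mf [M Mf]].
have sub : `[0, t] `<=` `[0, T].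
  move=> x /=; rewrite !in_itv /= => /andP[-> xt].
  exact: le_trans tT.
apply: measurable_bounded_integrable => //.
- by rewrite /= lebesgue_measure_itv /=; case: ifP => _; rewrite ?ltry.
- exact: measurable_funS mf.
- exists M; split; first exact: num_real.
  move=> N MN x /sub /=; rewrite in_itv /= => /Mf.
  by move=> fM; exact: le_trans (ltW MN).
Qed.

Lemma eq_within_continuous (R : realType) (T : R) (f g : R -> R) :
  (forall x, 0 <= x <= T -> f x = g x) ->
  {within `[0, T], continuous f} -> {within `[0, T], continuous g}.
Proof.
move=> fg; apply: subspace_eq_continuous => x /set_mem /=.
by rewrite in_itv /=; exact: fg.
Qed.

Lemma primitive_within_continuous (R : realType) (T c : R)
    (f F : R -> R) :
  0 < T -> bounded_measurable T f ->
  (forall t : R, 0 <= t <= T ->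
    F t = c + \int[lebesgue_measure]_(x in `[0, t]) f x) ->
  {within `[0, T], continuous F}.
Proof.
move=> T0 bf FE.
have := @parameterized_integral_continuous R 0 T f (ltW T0)
  (bounded_measurable_integrable (lexx T) bf).
have cc : {within `[0, T], continuous (fun=> c : R)}.
  by apply: continuous_subspaceT => x; exact: cst_continuous.
move=> /(within_continuousD cc); apply: eq_within_continuous => x xT.
by rewrite fctE FE.
Qed.

(** [F] is tied to the integral on [[0, T]] only, as solutions are unspecified elsewhere; at an
    interior point this is agreement on a neighbourhood, which determines the derivative. *)
Lemma primitive_is_derive (R : realType) (T c t : R) (f F : R -> R) :
  bounded_measurable T f ->
  (forall t : R, 0 <= t <= T ->
    F t = c + \int[lebesgue_measure]_(x in `[0, t]) f x) ->
  0 < t < T -> {for t, continuous f} -> is_derive t 1 F (f t).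
Proof.
move=> bf FE /andP[t0 tT] ct.
have [dI I'] := @continuous_FTC1_closed R f 0 t T tT
  (bounded_measurable_integrable (lexx T) bf) t0 ct.
have : is_derive t 1 (fun s => c + \int[lebesgue_measure]_(x in `[0, s]) f x)
    (0 + f t).
  apply: is_deriveD; apply: DeriveDef => //.
  by rewrite -I' derive1E.
rewrite add0r; apply: near_eq_is_derive.
have : t \in `]0, T[ by rewrite in_itv /= t0.
move=> /near_in_itvoo; apply: filterS => s; rewrite in_itv /= => /andP[s0 sT].
by rewrite FE ?ltW.
Qed.

(** Induction on [D], for all intervals at once: an exceptional point inside []a, b[] splits the
    interval, and continuity there lets the two halves share the value [f d]. Without exceptional
    points this is the mean value theorem. *)
Lemma derive_zero_off_finite_eq (R : realType) (D : seq R) (f : R -> R)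
    (a b : R) : a <= b -> {within `[a, b], continuous f} ->
  (forall x, a < x < b -> x \notin D -> is_derive x 1 f 0) -> f a = f b.
Proof.
elim: D a b => [|d D IH] a b ab cf df.
  move: ab; rewrite le_eqVlt => /predU1P[->//|ab].
  have [x|c _] := @MVT R f (fun=> 0) a b ab _ cf.
    by rewrite in_itv /= => xab; exact: df.
  by rewrite mul0r => /eqP; rewrite subr_eq0 => /eqP.
have [dab|dab] := boolP (a < d < b); last first.
  apply: IH => // x xab xD; apply: df => //.
  rewrite inE negb_or xD andbT; apply: contraNneq dab => <-; exact: xab.
have /andP[ad db] := dab.
transitivity (f d).
  apply: IH => [||x /andP[ax xd] xD]; first exact: ltW.
    apply: continuous_subspaceW cf; apply: subset_itvl.
    by rewrite bnd_simp ltW.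
  apply: df; first by rewrite ax (lt_trans xd).
  by rewrite inE negb_or xD andbT lt_eqF.
apply: IH => [||x /andP[dx xb] xD]; first exact: ltW.
  apply: continuous_subspaceW cf; apply: subset_itvr.
  by rewrite bnd_simp ltW.
apply: df; first by rewrite xb (lt_trans ad).
by rewrite inE negb_or xD andbT gt_eqF.
Qed.

(** * Picard iteration *)

Lemma continuous_expRZ (R : realType) (k : R) :
  continuous (fun s => expR (k * s)).
Proof.
move=> x; apply: continuous_comp; first exact: mulrl_continuous.
exact: continuous_expR.
Qed.

(** The primitive [F] and [expR (k * s)] have the same derivative, so their difference keeps its
    value at [0]. *)
Lemma integral_expR (R : realType) (k t : R) : 0 <= t ->
  \int[lebesgue_measure]_(s in `[0, t]) (k * expR (k * s)) = expR (k * t) - 1.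
Proof.
rewrite le_eqVlt => /predU1P[<-|t0].
  by rewrite set_itv1 Rintegral_set1 mulr0 expR0 subrr.
have dE (x : R) : is_derive x 1 (fun s => expR (k * s)) (k * expR (k * x)).
  rewrite mulrC; apply: (is_derive1_comp (g := fun s => k * s)).
  have := is_deriveZ k (is_derive_id x (1 : R)).
  by rewrite /GRing.scale /= mulr1.
have cE : continuous (fun s => k * expR (k * s)).
  move=> x; apply: cvgM; first exact: cvg_cst.
  exact: continuous_expRZ.
have bE : bounded_measurable t (fun s => k * expR (k * s)).
  exact/within_continuous_bounded_measurable/continuous_subspaceT.
pose F s := 0 + \int[lebesgue_measure]_(x in `[0, s]) (k * expR (k * x)).
have F0 : F 0 = 0 by rewrite /F set_itv1 Rintegral_set1 addr0.
have : F 0 - expR (k * 0) = F t - expR (k * t).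
  apply: (@derive_zero_off_finite_eq R [::] (fun s => F s - expR (k * s))).
  - exact: ltW.
  - apply: within_continuousB; first exact: (primitive_within_continuous (c := 0) _ bE).
    by apply: continuous_subspaceT; exact: continuous_expRZ.
  move=> x xt _; rewrite -(subrr (k * expR (k * x))).
  have dF : is_derive x 1 F (k * expR (k * x)).
    by apply: (primitive_is_derive (c := 0) bE _ xt); [|exact: cE].
  exact: (is_deriveB dF (dE x)).
rewrite F0 mulr0 expR0 /F !add0r => /esym/eqP; rewrite subr_eq => /eqP ->.
by rewrite addrC.
Qed.

(** The [n]-th term of the Neumann series of [x' = g x], [x(0) = c]: the Volterra operator with
    kernel [g] applied [n] times to the constant vector [c]. *)
Fixpoint picard_term (R : realType) (I : finType) (g : I -> I -> R -> R)
    (c : I -> R) (n : nat) (a : I) (t : R) : R :=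
  if n is k.+1 then
    \int[lebesgue_measure]_(s in `[0, t]) \sum_b g a b s * picard_term g c k b s
  else c a.

Lemma picard_term_continuous (R : realType) (T : R) (I : finType)
    (g : I -> I -> R -> R) (c : I -> R) (n : nat) (a : I) : 0 < T ->
  (forall a b, bounded_measurable T (g a b)) ->
  {within `[0, T], continuous (picard_term g c n a)}.
Proof.
move=> T0 bg; elim: n a => [|n IH] a /=.
  by apply: continuous_subspaceT => x; exact: cst_continuous.
apply: (@primitive_within_continuous _ _ 0
  (fun s => \sum_b g a b s * picard_term g c n b s)) => //; last first.
  by move=> t tT; rewrite add0r.
apply: bounded_measurable_sum => b; apply: bounded_measurableM => //.
exact: within_continuous_bounded_measurable.
Qed.

(* The weight expR (2 K t) makes the Picard map a contraction of ratio 1/2. *)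
Lemma picard_term_bound (R : realType) (T K C : R) (I : finType)
    (g : I -> I -> R -> R) (c : I -> R) (n : nat) (a : I) (t : R) :
  0 < T -> (forall a b, bounded_measurable T (g a b)) ->
  0 <= K -> (forall a s, 0 <= s <= T -> \sum_b `|g a b s| <= K) ->
  (forall a, `|c a| <= C) -> 0 <= t <= T ->
  `|picard_term g c n a t| <= C * 2^-1 ^+ n * expR (2 * K * t).
Proof.
move=> T0 bg K0 gK cC; elim: n a t => [|n IH] a t tT /=.
  have C0 : 0 <= C by apply: le_trans (cC a).
  rewrite expr0 mulr1; apply: le_trans (cC a) _.
  rewrite ler_peMr // -expR0 ler_expR.
  by case/andP: tT => t0 _; rewrite !mulr_ge0.
have C0 : 0 <= C by apply: le_trans (cC a).
have /andP[t0 tT'] := tT.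
have bf : bounded_measurable T (fun s => \sum_b g a b s * picard_term g c n b s).
  apply: bounded_measurable_sum => b; apply: bounded_measurableM => //.
  exact/within_continuous_bounded_measurable/picard_term_continuous.
have intf := bounded_measurable_integrable tT' bf.
have bE : bounded_measurable T (fun s => 2 * K * expR (2 * K * s)).
  apply: within_continuous_bounded_measurable; apply: continuous_subspaceT => x.
  apply: cvgM; first exact: cvg_cst.
  exact: continuous_expRZ.
have intE := bounded_measurable_integrable tT' bE.
apply: le_trans (le_normr_Rintegral _ intf) _ => //.
(* The majorant is a multiple of the derivative [2 * K * expR (2 * K * s)], so its integral is
   explicit; writing [K] as half of [2 * K] is what produces the extra factor [2^-1]. *)
apply: (@le_trans _ _ (\int[lebesgue_measure]_(s in `[0, t])
    (C * 2^-1 ^+ n.+1 * (2 * K * expR (2 * K * s))))).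
  apply: le_Rintegral => //.
  - by move/integrable_norm: intf.
  - by have := integrableZl _ (C * 2^-1 ^+ n.+1) intE; exact.
  move=> s /=; rewrite in_itv /= => /andP[s0 st].
  have sT : 0 <= s <= T by rewrite s0 (le_trans st).
  apply: le_trans (ler_norm_sum _ _ _) _.
  apply: (@le_trans _ _ (\sum_b `|g a b s| * (C * 2^-1 ^+ n * expR (2 * K * s)))).
    by apply: ler_sum => b _; rewrite normrM ler_wpM2l // IH.
  rewrite -mulr_suml.
  have -> : C * 2^-1 ^+ n.+1 * (2 * K * expR (2 * K * s)) =
      K * (C * 2^-1 ^+ n * expR (2 * K * s)).
    by rewrite exprS; field.
  by rewrite ler_wpM2r ?gK // !mulr_ge0 ?expR_ge0 // exprn_ge0 // invr_ge0.
rewrite RintegralZl // integral_expR //.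
rewrite ler_wpM2l ?mulr_ge0 ?exprn_ge0 ?invr_ge0 //.
by rewrite gerDl lerN10.
Qed.

Lemma cvg_sum_seq (R : realType) (J I : Type) (r : seq I) (F : set_system J)
    {FF : Filter F} (f : I -> J -> R) (l : I -> R) :
  (forall i, f i j @[j --> F] --> l i) ->
  \sum_(i <- r) f i j @[j --> F] --> \sum_(i <- r) l i.
Proof.
move=> fl; elim: r => [|i r IH].
  by under eq_fun do rewrite big_nil; rewrite big_nil; exact: cvg_cst.
by under eq_fun do rewrite big_cons; rewrite big_cons; exact: cvgD.
Qed.

(** Dominated convergence with the constant [M] as dominating function; the limit inherits both
    measurability and the bound from the sequence. *)
Lemma cvg_bounded_Rintegral (R : realType) (t M : R) (f_ : nat -> R -> R)
    (f : R -> R) :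
  (forall n, measurable_fun `[0, t] (f_ n)) ->
  (forall x, 0 <= x <= t -> f_ n x @[n --> \oo] --> f x) ->
  (forall n x, 0 <= x <= t -> `|f_ n x| <= M) ->
  \int[lebesgue_measure]_(x in `[0, t]) f_ n x @[n --> \oo] -->
  \int[lebesgue_measure]_(x in `[0, t]) f x.
Proof.
move=> mf ff fM; apply: fine_cvg.
have itv x : `[0, t]%classic x -> 0 <= x <= t by rewrite /= in_itv.
have intM : lebesgue_measure.-integrable `[0, t] (EFin \o (fun=> M : R)).
  exact: bounded_measurable_integrable (lexx t) (bounded_measurable_cst _ _).
have mlim : measurable_fun `[0, t] f.
  by apply: (measurable_fun_cvg mf) => x /itv; exact: ff.
have intf : lebesgue_measure.-integrable `[0, t] (EFin \o f).
  apply: (bounded_measurable_integrable (lexx t)); split=> //.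
  exists M => x xt; have /cvg_norm fx := ff x xt.
  apply: (cvgr_to_le fx); apply: nearW => n; exact: fM.
rewrite fineK; last exact: integrable_fin_num intf.
apply: (@dominated_cvg _ _ _ _ _ _ _ _ (EFin \o (fun=> M))) => //.
- by move=> n; apply/measurable_EFinP; exact: mf.
- by move=> x /itv xt; apply: cvg_EFin; [exact: nearW|exact: ff].
Qed.

Lemma linear_system_solution (R : realType) (T : R) (I : finType)
    (g : I -> I -> R -> R) (c : I -> R) :
  0 < T -> (forall a b, bounded_measurable T (g a b)) ->
  exists x : I -> R -> R,
    (forall a, {within `[0, T], continuous (x a)}) /\
    forall a t, 0 <= t <= T ->
      x a t = c a +
        \int[lebesgue_measure]_(s in `[0, t]) (\sum_b g a b s * x b s).
Proof.
move=> T0 bg.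
have [m Hm] : exists m : I -> I -> R, forall a b s, 0 <= s <= T ->
    `|g a b s| <= m a b.
  have h a b : {M | forall s, 0 <= s <= T -> `|g a b s| <= M}.
    by apply: cid; have [_] := bg a b.
  by exists (fun a b => sval (h a b)) => a b; exact: svalP (h a b).
(* Summing over the rows as well gives one bound for all row sums. *)
pose K := \sum_a \sum_b `|m a b|.
pose C := \sum_a `|c a|.
have K0 : 0 <= K by apply: sumr_ge0 => a _; exact: sumr_ge0.
have C0 : 0 <= C by exact: sumr_ge0.
have gK a s : 0 <= s <= T -> \sum_b `|g a b s| <= K.
  move=> sT; apply: (@le_trans _ _ (\sum_b `|m a b|)).
    by apply: ler_sum => b _; apply: le_trans (Hm _ _ _ sT) (ler_norm _).
  by rewrite /K [leRHS](bigD1 a) //= lerDl; apply: sumr_ge0 => i _; exact: sumr_ge0.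
have cC a : `|c a| <= C by rewrite /C (bigD1 a) //= lerDl sumr_ge0.
(* The exponential weight at its largest value on [[0, T]]: the terms are then dominated by a
   geometric series uniformly in [t]. *)
pose B := C * expR (2 * K * T).
have B0 : 0 <= B by rewrite mulr_ge0 ?expR_ge0.
pose d := picard_term g c.
have dB n a t : 0 <= t <= T -> `|d n a t| <= geometric B 2^-1 n.
  move=> tT; apply: le_trans (picard_term_bound n a T0 bg K0 gK cC tT) _.
  rewrite /B /geometric /= mulrAC ler_wpM2r ?exprn_ge0 ?invr_ge0 //.
  by rewrite ler_wpM2l // ler_expR ler_wpM2l ?mulr_ge0 //; case/andP: tT.
have half : `|2^-1 : R| < 1 by rewrite ger0_norm ?invr_ge0 // invf_lt1 // ltr1n.
have dc n a := @picard_term_continuous R T I g c n a T0 bg.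
have bd n a := within_continuous_bounded_measurable (dc n a).
pose S n a t := series (fun k => d k a t) n.
have bS n a : bounded_measurable T (S n a).
  by apply: bounded_measurable_sum => k; exact: bd.
have cS a t : 0 <= t <= T -> cvgn (S^~ a^~ t).
  move=> tT; apply: normed_cvg.
  apply: (@series_le_cvg _ _ (geometric B 2^-1)) => [n|n|n|].
  - exact: normr_ge0.
  - by rewrite /geometric /= mulr_ge0 // exprn_ge0 // invr_ge0.
  - exact: dB.
  - exact: is_cvg_geometric_series.
have SB n a t : 0 <= t <= T -> `|S n a t| <= B / (1 - 2^-1).
  move=> tT; apply: le_trans (geometric_le_lim n B0 _ half); last first.
    by rewrite invr_gt0.
  apply: le_trans (ler_norm_sum _ _ _) _.
  by apply: ler_sum => k _; exact: dB.
have bgS n a : bounded_measurable T (fun s => \sum_b g a b s * S n b s).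
  by apply: bounded_measurable_sum => b; exact: bounded_measurableM.
(* The partial sums are the Picard iterates. The sum [S 0] is empty, so the iteration starts at [0]
   and [S 1] is the constant [c]. *)
have SS n a t : t <= T -> S n.+1 a t =
    c a + \int[lebesgue_measure]_(s in `[0, t]) (\sum_b g a b s * S n b s).
  move=> tT; elim: n => [|n IH].
    rewrite /S /series /= big_nat1 /d /=.
    under eq_Rintegral => s _.
      rewrite big1; last by move=> b _; rewrite big_geq // mulr0.
      over.
    by rewrite /Rintegral integral0 addr0.
  rewrite /S /series /= big_nat_recr //= -[X in X + _]/(S n.+1 a t) IH -addrA.
  congr (_ + _); rewrite -RintegralD //.
  - apply: eq_Rintegral => s _; rewrite -big_split; apply: eq_bigr => b _ /=.
    by rewrite -mulrDr /S /series /= big_nat_recr.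
  - by apply: (bounded_measurable_integrable tT); exact: bgS.
  - apply: (bounded_measurable_integrable tT).
    by apply: bounded_measurable_sum => b; exact: bounded_measurableM.
pose x a t := limn (S^~ a^~ t).
have Sx a t : 0 <= t <= T -> S n a t @[n --> \oo] --> x a t by exact: cS.
have xE a t : 0 <= t <= T -> x a t = c a +
    \int[lebesgue_measure]_(s in `[0, t]) (\sum_b g a b s * x b s).
  move=> /[dup] tT /andP[t0 tT'].
  have sub s : 0 <= s <= t -> 0 <= s <= T.
    by move=> /andP[-> st]; rewrite (le_trans st).
  (* Both sides of [SS] pass to the limit, the right one by bounded convergence, and uniqueness of
     limits gives the integral equation. *)
  have : S n.+1 a t @[n --> \oo] --> x a t by rewrite cvg_shiftS; exact: Sx.
  under eq_fun do rewrite SS //.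
  move/cvg_lim => <- //; apply: cvg_lim => //.
  apply: cvgD; first exact: cvg_cst.
  apply: (@cvg_bounded_Rintegral _ _ (K * (B / (1 - 2^-1)))).
  - have subs : `[0, t] `<=` `[0, T] by move=> s /=; rewrite !in_itv; exact: sub.
    by move=> n; exact: measurable_funS subs (bgS n a).1.
  - move=> s st; apply: cvg_sum_seq => b; apply: cvgM; first exact: cvg_cst.
    exact/Sx/sub.
  - move=> n s /sub sT; apply: le_trans (ler_norm_sum _ _ _) _.
    apply: (@le_trans _ _ (\sum_b `|g a b s| * (B / (1 - 2^-1)))).
      by apply: ler_sum => b _; rewrite normrM ler_wpM2l ?SB.
    rewrite -mulr_suml ler_wpM2r ?gK // mulr_ge0 // invr_ge0 subr_ge0.
    by rewrite ltW // -[X in X < _]ger0_norm ?invr_ge0.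
exists x; split=> // a.
have bx b : bounded_measurable T (x b).
  split; last first.
    exists (B / (1 - 2^-1)) => t tT; have /cvg_norm Sn := Sx b t tT.
    by apply: (cvgr_to_le Sn); apply: nearW => n; exact: SB.
  apply: (measurable_fun_cvg (fun n => (bS n b).1)) => t /=.
  by rewrite in_itv; exact: Sx.
apply: (primitive_within_continuous T0 _ (xE a)).
by apply: bounded_measurable_sum => b; exact: bounded_measurableM.
Qed.

(** * Matrix-valued functions *)

(** [mx_continuous_at], [mx_continuous_on] and [mx_piecewise_continuous] unfold to instances of
    this, so stability under products or block assembly can be proved once for a general class
    [C]. *)
Definition entrywise (R : realType) (C : (R -> R) -> Prop) (p q : nat)
    (F : R -> 'M[R[i]]_(p, q)) : Prop :=
  forall i j, C (entry_Re F i j) /\ C (entry_Im F i j).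

Lemma complex_ReD (R : realType) (x y : R[i]) :
  complex.Re (x + y) = complex.Re x + complex.Re y.
Proof. by case: x y => [a b] [c d]. Qed.

Lemma complex_ImD (R : realType) (x y : R[i]) :
  complex.Im (x + y) = complex.Im x + complex.Im y.
Proof. by case: x y => [a b] [c d]. Qed.

Lemma complex_ReM (R : realType) (x y : R[i]) :
  complex.Re (x * y) =
  complex.Re x * complex.Re y - complex.Im x * complex.Im y.
Proof. by case: x y => [a b] [c d]. Qed.

Lemma complex_ImM (R : realType) (x y : R[i]) :
  complex.Im (x * y) =
  complex.Re x * complex.Im y + complex.Im x * complex.Re y.
Proof. by case: x y => [a b] [c d]. Qed.

Lemma complex_Re_sum (R : realType) (I : Type) (r : seq I) (P : pred I)
    (F : I -> R[i]) :
  complex.Re (\sum_(i <- r | P i) F i) = \sum_(i <- r | P i) complex.Re (F i).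
Proof. by apply: (big_morph _ (@complex_ReD R)). Qed.

Lemma complex_Im_sum (R : realType) (I : Type) (r : seq I) (P : pred I)
    (F : I -> R[i]) :
  complex.Im (\sum_(i <- r | P i) F i) = \sum_(i <- r | P i) complex.Im (F i).
Proof. by apply: (big_morph _ (@complex_ImD R)). Qed.

Lemma entry_Re_mulmx (R : realType) (p q r : nat) (A : R -> 'M[R[i]]_(p, q))
    (B : R -> 'M[R[i]]_(q, r)) i k :
  entry_Re (fun t => A t *m B t) i k =
  (fun t => \sum_j (entry_Re A i j t * entry_Re B j k t -
                    entry_Im A i j t * entry_Im B j k t)).
Proof.
apply/funext => t; rewrite /entry_Re mxE complex_Re_sum.
by under eq_bigr do rewrite complex_ReM.
Qed.

Lemma entry_Im_mulmx (R : realType) (p q r : nat) (A : R -> 'M[R[i]]_(p, q))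
    (B : R -> 'M[R[i]]_(q, r)) i k :
  entry_Im (fun t => A t *m B t) i k =
  (fun t => \sum_j (entry_Re A i j t * entry_Im B j k t +
                    entry_Im A i j t * entry_Re B j k t)).
Proof.
apply/funext => t; rewrite /entry_Im mxE complex_Im_sum.
by under eq_bigr do rewrite complex_ImM.
Qed.

Lemma entrywise_mulmx (R : realType) (C : (R -> R) -> Prop) (p q r : nat)
    (A : R -> 'M[R[i]]_(p, q)) (B : R -> 'M[R[i]]_(q, r)) :
  C (fun=> 0) -> (forall f g, C f -> C g -> C (f \+ g)) ->
  (forall f g, C f -> C g -> C (f \- g)) ->
  (forall f g, C f -> C g -> C (f \* g)) ->
  entrywise C A -> entrywise C B -> entrywise C (fun t => A t *m B t).
Proof.
move=> C0 CD CB CM CA CF i k.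
have Csum (s : seq 'I_q) (F : 'I_q -> R -> R) : (forall j, C (F j)) ->
    C (fun t => \sum_(j <- s) F j t).
  move=> CFj; elim: s => [|j s IH]; first by under eq_fun do rewrite big_nil.
  by under eq_fun do rewrite big_cons; exact: CD.
rewrite entry_Re_mulmx entry_Im_mulmx.
split; apply: Csum => j; have [AR AI] := CA i j; have [BR BI] := CF j k.
  by apply: CB; exact: CM.
by apply: CD; exact: CM.
Qed.

Definition mx_bounded_measurable (R : realType) (T : R) (p q : nat) :=
  @entrywise R (bounded_measurable T) p q.

Lemma mx_bounded_measurable_mulmx (R : realType) (T : R) (p q r : nat)
    (A : R -> 'M[R[i]]_(p, q)) (B : R -> 'M[R[i]]_(q, r)) :
  mx_bounded_measurable T A -> mx_bounded_measurable T B ->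
  mx_bounded_measurable T (fun t => A t *m B t).
Proof.
apply: entrywise_mulmx.
- exact: bounded_measurable_cst.
- by move=> f g; exact: bounded_measurableD.
- by move=> f g bf bg; apply: bounded_measurableD => //; exact: bounded_measurableN.
- by move=> f g; exact: bounded_measurableM.
Qed.

Lemma mx_continuous_at_mulmx (R : realType) (t : R) (p q r : nat)
    (A : R -> 'M[R[i]]_(p, q)) (B : R -> 'M[R[i]]_(q, r)) :
  mx_continuous_at A t -> mx_continuous_at B t ->
  mx_continuous_at (fun t => A t *m B t) t.
Proof.
apply: (@entrywise_mulmx _ (fun f => {for t, continuous f})).
- exact: cst_continuous.
- by move=> f g; exact: continuousD.
- by move=> f g; exact: continuousB.
- by move=> f g; exact: continuousM.
Qed.

Lemma mx_continuous_on_mulmx (R : realType) (T : R) (p q r : nat)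
    (A : R -> 'M[R[i]]_(p, q)) (B : R -> 'M[R[i]]_(q, r)) :
  mx_continuous_on T A -> mx_continuous_on T B ->
  mx_continuous_on T (fun t => A t *m B t).
Proof.
apply: (@entrywise_mulmx _ (fun f => {within `[0, T], continuous f})).
- by apply: continuous_subspaceT => x; exact: cst_continuous.
- by move=> f g; exact: within_continuousD.
- by move=> f g; exact: within_continuousB.
- move=> f g /subspace_continuousP cf /subspace_continuousP cg.
  by apply/subspace_continuousP => x xT; apply: cvgM; [exact: cf|exact: cg].
Qed.

Lemma mx_continuous_on_at (R : realType) (T t : R) (p q : nat)
    (A : R -> 'M[R[i]]_(p, q)) :
  mx_continuous_on T A -> 0 < t < T -> mx_continuous_at A t.
Proof.
move=> cA tT i j; have [cR cI] := cA i j.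
have T0 : 0 < T by case/andP: tT; exact: lt_trans.
by split; apply: (within_continuous_continuous T0) => //; rewrite in_itv.
Qed.

Lemma mx_continuous_on_bounded_measurable (R : realType) (T : R) (p q : nat)
    (A : R -> 'M[R[i]]_(p, q)) :
  mx_continuous_on T A -> mx_bounded_measurable T A.
Proof.
by move=> cA i j; split; apply: within_continuous_bounded_measurable;
  case: (cA i j).
Qed.

Lemma mx_piecewise_continuous_bounded_measurable (R : realType) (T : R)
    (p q : nat) (A : R -> 'M[R[i]]_(p, q)) :
  0 < T -> mx_piecewise_continuous T A -> mx_bounded_measurable T A.
Proof.
by move=> T0 cA i j; split; apply: piecewise_continuous_bounded_measurable => //;
  case: (cA i j).
Qed.

Lemma mx_is_derive_mulmx (R : realType) (t : R) (p q r : nat)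
    (A : R -> 'M[R[i]]_(p, q)) (B : R -> 'M[R[i]]_(q, r)) dA dB :
  mx_is_derive A t dA -> mx_is_derive B t dB ->
  mx_is_derive (fun t => A t *m B t) t (dA *m B t + A t *m dB).
Proof.
have dsum (f : 'I_q -> R -> R) df : (forall j, is_derive t 1 (f j) (df j)) ->
    is_derive t 1 (fun s => \sum_j f j s) (\sum_j df j).
  have -> : (fun s => \sum_j f j s) = \sum_j f j.
    by apply/funext => s; rewrite fct_sumE.
  exact: is_derive_sum.
move=> HA HB i k; rewrite entry_Re_mulmx entry_Im_mulmx !mxE.
rewrite -big_split complex_Re_sum complex_Im_sum /=.
split; apply: dsum => j; have [AR AI] := HA i j; have [BR BI] := HB j k.
  apply: (is_derive_eq (is_deriveB (is_deriveM AR BR) (is_deriveM AI BI))).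
  rewrite /entry_Re /entry_Im /GRing.scale /= complex_ReD !complex_ReM.
  by ring.
apply: (is_derive_eq (is_deriveD (is_deriveM AR BI) (is_deriveM AI BR))).
rewrite /entry_Re /entry_Im /GRing.scale /= complex_ImD !complex_ImM.
by ring.
Qed.

Lemma mx_derive_zero_off_finite_eq (R : realType) (T : R) (D : seq R)
    (p q : nat) (F : R -> 'M[R[i]]_(p, q)) :
  mx_continuous_on T F ->
  (forall x, 0 < x < T -> x \notin D -> mx_is_derive F x 0) ->
  forall t, 0 <= t <= T -> F t = F 0.
Proof.
move=> cF dF t /andP[t0 tT]; apply/matrixP => i j; have [cR cI] := cF i j.
have sub : `[0, t] `<=` `[0, T].
  by move=> x /=; rewrite !in_itv /= => /andP[->] /le_trans; exact.
have cst (f : R -> R) : {within `[0, T], continuous f} ->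
    (forall x, 0 < x < T -> x \notin D -> is_derive x 1 f 0) -> f 0 = f t.
  move=> cf df; apply: (@derive_zero_off_finite_eq _ D) => //.
    exact: continuous_subspaceW cf.
  by move=> x /andP[x0 xt]; apply: df; rewrite x0 (lt_le_trans xt).
apply/eqP; rewrite eq_complex; apply/andP; split; apply/eqP/esym.
  apply: (cst _ cR) => x xT xD.
  by have [+ _] := dF x xT xD i j; rewrite mxE.
apply: (cst _ cI) => x xT xD.
by have [_ +] := dF x xT xD i j; rewrite mxE.
Qed.

(** The exceptional lists of the finitely many entries are chosen and concatenated. *)
Lemma mx_piecewise_continuous_off_finite (R : realType) (T : R) (p q : nat)
    (A : R -> 'M[R[i]]_(p, q)) :
  mx_piecewise_continuous T A ->
  exists D : seq R, forall t, 0 < t < T -> t \notin D -> mx_continuous_at A t.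
Proof.
move=> cA.
have h i j : {D : seq R | forall t, 0 < t < T -> t \notin D ->
    {for t, continuous (entry_Re A i j)} /\ {for t, continuous (entry_Im A i j)}}.
  apply: cid; have [[D [cR _ _]] [D' [cI _ _]]] := cA i j.
  exists (D ++ D') => t tT; rewrite mem_cat negb_or => /andP[tD tD'].
  by split; [exact: cR|exact: cI].
exists (flatten [seq sval (h ij.1 ij.2) | ij <- enum {: 'I_p * 'I_q}]).
move=> t tT tD i j; apply: (svalP (h i j)) => //.
apply: contra tD => tD; apply/flatten_mapP; exists (i, j) => //.
exact: mem_enum.
Qed.

(** * Linear initial value problems *)

(** The bridge from integral equations to initial value problems. As [f] may itself involve [F], it
    serves both [U] and the iterated integrals. *)
Lemma mx_primitive (R : realType) (T : R) (p q : nat)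
    (c : 'M[R[i]]_(p, q)) (F f : R -> 'M[R[i]]_(p, q)) :
  0 < T -> mx_bounded_measurable T f ->
  (forall t, 0 <= t <= T -> F t = c + mx_integral 0 t f) ->
  [/\ mx_continuous_on T F, F 0 = c
    & forall t, 0 < t < T -> mx_continuous_at f t -> mx_is_derive F t (f t)].
Proof.
move=> T0 bf FE.
have FR i j t : 0 <= t <= T -> entry_Re F i j t = complex.Re (c i j) +
    \int[lebesgue_measure]_(x in `[0, t]) entry_Re f i j x.
  by move=> tT; rewrite /entry_Re FE // !mxE complex_ReD.
have FI i j t : 0 <= t <= T -> entry_Im F i j t = complex.Im (c i j) +
    \int[lebesgue_measure]_(x in `[0, t]) entry_Im f i j x.
  by move=> tT; rewrite /entry_Im FE // !mxE complex_ImD.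
split=> [i j||t tT ct i j]; have TT : 0 <= (0 : R) <= T by rewrite lexx ltW.
- have [bR bI] := bf i j; split.
    exact: primitive_within_continuous bR (FR i j).
  exact: primitive_within_continuous bI (FI i j).
- apply/matrixP => i j; apply/eqP; rewrite eq_complex.
  rewrite -[complex.Re (F 0 i j)]/(entry_Re F i j 0) FR //.
  rewrite -[complex.Im (F 0 i j)]/(entry_Im F i j 0) FI //.
  by rewrite set_itv1 !Rintegral_set1 !addr0 !eqxx.
have [bR bI] := bf i j; have [cR cI] := ct i j; split.
  exact: (primitive_is_derive bR (FR i j) tT cR).
exact: (primitive_is_derive bI (FI i j) tT cI).
Qed.

Lemma integral_equation_solution (R : realType) (T : R) (N : nat)
    (G : R -> 'M[R[i]]_N) : 0 < T -> mx_bounded_measurable T G ->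
  exists2 U : R -> 'M[R[i]]_N, mx_continuous_on T U &
    forall t, 0 <= t <= T -> U t = 1%:M + mx_integral 0 t (fun s => G s *m U s).
Proof.
move=> T0 bG.
(* Realification: [(i, false)] indexes the real part and [(i, true)] the imaginary part of
   coordinate [i], and [g] is the real matrix with block rows [(Re G, - Im G)] and
   [(Im G, Re G)]. *)
pose g (a b : 'I_N * bool) : R -> R :=
  if a.2 == b.2 then entry_Re G a.1 b.1
  else if a.2 then entry_Im G a.1 b.1 else \- entry_Im G a.1 b.1.
have bg a b : bounded_measurable T (g a b).
  have [bR bI] := bG a.1 b.1.
  by rewrite /g; do 2?case: ifP => _ //; exact: bounded_measurableN.
(* The columns of [U] decouple: column [k] solves the same real system, started at column [k] of the
   identity. *)
pose c (k : 'I_N) (a : 'I_N * bool) : R := if a.2 then 0 else (a.1 == k)%:R.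
have [x Hx] := choice (fun k => linear_system_solution (c k) T0 bg).
exists (fun t => \matrix_(i, k) Complex (x k (i, false) t) (x k (i, true) t)).
  move=> i k; have [cx _] := Hx k.
  have -> : entry_Re (fun t => \matrix_(i, k)
      Complex (x k (i, false) t) (x k (i, true) t)) i k = x k (i, false).
    by apply/funext => t; rewrite /entry_Re mxE.
  have -> : entry_Im (fun t => \matrix_(i, k)
      Complex (x k (i, false) t) (x k (i, true) t)) i k = x k (i, true).
    by apply/funext => t; rewrite /entry_Im mxE.
  by split; exact: cx.
move=> t tT; apply/matrixP => i k; have [_ xE] := Hx k.
have sumE (h : 'I_N * bool -> R) : \sum_a h a =
    \sum_j (h (j, true) + h (j, false)).
  transitivity (\sum_j \sum_b h (j, b)).
    by rewrite pair_bigA; apply: eq_bigr => -[].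
  by apply: eq_bigr => j _; rewrite big_bool.
rewrite !mxE (xE (i, false)) // (xE (i, true)) // entry_Re_mulmx entry_Im_mulmx.
apply/eqP; rewrite eq_complex /= complex_ReD complex_ImD /= /c /=.
apply/andP; split; apply/eqP.
  congr (_ + _); first by case: (i == k).
  apply: eq_Rintegral => s _; rewrite sumE; apply: eq_bigr => j _.
  by rewrite /g /entry_Re /entry_Im /= !mxE /= mulNr addrC.
congr (_ + _); first by case: (i == k).
apply: eq_Rintegral => s _; rewrite sumE; apply: eq_bigr => j _.
by rewrite /g /entry_Re /entry_Im /= !mxE.
Qed.

Lemma ivp_solution_exists (R : realType) (T : R) (N : nat)
    (G : R -> 'M[R[i]]_N) : 0 < T -> mx_piecewise_continuous T G ->
  exists U, is_ivp_solution T G U.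
Proof.
move=> T0 /(mx_piecewise_continuous_bounded_measurable T0) bG.
have [U cU UE] := integral_equation_solution T0 bG.
have bU := mx_continuous_on_bounded_measurable cU.
have [_ U0 dU] := mx_primitive T0 (mx_bounded_measurable_mulmx bG bU) UE.
exists U; split=> // t tT ct; apply: dU => //.
exact: mx_continuous_at_mulmx ct (mx_continuous_on_at cU tT).
Qed.

Lemma piecewise_continuousN (R : realType) (T : R) (f : R -> R) :
  piecewise_continuous T f -> piecewise_continuous T (\- f).
Proof.
case=> D [fc fr fl]; exists D; split=> t.
- by move=> tT tD; apply: continuousN; exact: fc.
- by move=> /fr /cvg_ex[l fr_l]; apply/cvg_ex; exists (- l); exact: cvgN.
- by move=> /fl /cvg_ex[l fl_l]; apply/cvg_ex; exists (- l); exact: cvgN.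
Qed.

Lemma entry_Re_trmxN (R : realType) (p q : nat) (A : R -> 'M[R[i]]_(p, q)) i j :
  entry_Re (fun t => - (A t)^T) i j = \- entry_Re A j i.
Proof. by apply/funext => t; rewrite /entry_Re !mxE /=; case: (A t j i). Qed.

Lemma entry_Im_trmxN (R : realType) (p q : nat) (A : R -> 'M[R[i]]_(p, q)) i j :
  entry_Im (fun t => - (A t)^T) i j = \- entry_Im A j i.
Proof. by apply/funext => t; rewrite /entry_Im !mxE /=; case: (A t j i). Qed.

Lemma entry_Re_trmx (R : realType) (p q : nat) (A : R -> 'M[R[i]]_(p, q)) i j :
  entry_Re (fun t => (A t)^T) i j = entry_Re A j i.
Proof. by apply/funext => t; rewrite /entry_Re !mxE. Qed.

Lemma entry_Im_trmx (R : realType) (p q : nat) (A : R -> 'M[R[i]]_(p, q)) i j :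
  entry_Im (fun t => (A t)^T) i j = entry_Im A j i.
Proof. by apply/funext => t; rewrite /entry_Im !mxE. Qed.

Definition is_adjoint_solution (R : realType) (T : R) (N : nat)
    (G Y : R -> 'M[R[i]]_N) : Prop :=
  [/\ mx_continuous_on T Y,
      Y 0 = 1%:M
    & forall t, 0 < t < T -> mx_continuous_at G t ->
        mx_is_derive Y t (- (Y t *m G t))].

(** Transposition turns [Y' = - Y G] into [Z' = - G^T Z], an initial value problem of the kind
    already solved. *)
Lemma adjoint_solution_exists (R : realType) (T : R) (N : nat)
    (G : R -> 'M[R[i]]_N) : 0 < T -> mx_piecewise_continuous T G ->
  exists Y, is_adjoint_solution T G Y.
Proof.
move=> T0 pG.
have pG' : mx_piecewise_continuous T (fun t => - (G t)^T).
  move=> i j; rewrite entry_Re_trmxN entry_Im_trmxN.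
  by have [pR pI] := pG j i; split; exact: piecewise_continuousN.
have [Z [cZ Z0 dZ]] := ivp_solution_exists T0 pG'.
exists (fun t => (Z t)^T); split=> [i j||t tT ct i j].
- by rewrite entry_Re_trmx entry_Im_trmx.
- by rewrite Z0 trmx1.
have /(dZ t tT)/(_ j i) : mx_continuous_at (fun t => - (G t)^T) t.
  move=> k l; rewrite entry_Re_trmxN entry_Im_trmxN.
  by have [cR cI] := ct l k; split; exact: continuousN.
rewrite entry_Re_trmx entry_Im_trmx.
suff -> : (- (G t)^T *m Z t) j i = (- ((Z t)^T *m G t)) i j by [].
by rewrite mulNmx -[Z t in LHS]trmxK -trmx_mul !mxE.
Qed.

Lemma adjoint_solution_mulmx (R : realType) (T : R) (N : nat)
    (G Y U : R -> 'M[R[i]]_N) :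
  mx_piecewise_continuous T G -> is_adjoint_solution T G Y ->
  is_ivp_solution T G U -> forall t, 0 <= t <= T -> Y t *m U t = 1%:M.
Proof.
move=> pG [cY Y0 dY] [cU U0 dU] t tT.
have [D HD] := mx_piecewise_continuous_off_finite pG.
have -> := mx_derive_zero_off_finite_eq (D := D) (mx_continuous_on_mulmx cY cU) _ tT.
  by rewrite Y0 U0 mulmx1.
move=> x xT xD; have ct := HD x xT xD.
have := mx_is_derive_mulmx (dY x xT ct) (dU x xT ct).
by rewrite mulNmx mulmxA addNr.
Qed.

Lemma ivp_solution_unique (R : realType) (T : R) (N : nat)
    (G U V : R -> 'M[R[i]]_N) :
  0 < T -> mx_piecewise_continuous T G ->
  is_ivp_solution T G U -> is_ivp_solution T G V ->
  forall t, 0 <= t <= T -> U t = V t.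
Proof.
move=> T0 pG sU sV t tT; have [Y sY] := adjoint_solution_exists T0 pG.
have YU := adjoint_solution_mulmx pG sY sU tT.
have YV := adjoint_solution_mulmx pG sY sV tT.
(* [V = (U Y) V = U (Y V) = U]: a left inverse of a square matrix is also a right inverse. *)
by rewrite -[RHS]mul1mx -(mulmx1C YU) -mulmxA YV mulmx1.
Qed.

Lemma time_ordered_exp_solution (R : realType) (T : R) (N : nat)
    (G : R -> 'M[R[i]]_N) : 0 < T -> mx_piecewise_continuous T G ->
  is_ivp_solution T G (time_ordered_exp T G).
Proof.
move=> T0 pG; have [U sU] := ivp_solution_exists T0 pG.
exact: (xgetI (fun=> 1%:M) sU).
Qed.

(** * Iterated integrals *)

Lemma Rintegral_sum_seq (R : realType) (t : R) (I : Type) (r : seq I)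
    (f : I -> R -> R) :
  (forall i, bounded_measurable t (f i)) ->
  \int[lebesgue_measure]_(x in `[0, t]) (\sum_(i <- r) f i x) =
  \sum_(i <- r) \int[lebesgue_measure]_(x in `[0, t]) f i x.
Proof.
move=> bf; elim: r => [|i r IH].
  under eq_Rintegral do rewrite big_nil.
  by rewrite /Rintegral integral0 big_nil.
under eq_Rintegral do rewrite big_cons.
rewrite RintegralD ?big_cons ?IH //.
  exact: (bounded_measurable_integrable (lexx t) (bf i)).
by apply: (bounded_measurable_integrable (lexx t)); exact: bounded_measurable_sum.
Qed.

Lemma eq_mx_integral (R : realType) (t : R) (p q : nat)
    (F F' : R -> 'M[R[i]]_(p, q)) :
  (forall s, 0 <= s <= t -> F s = F' s) ->
  mx_integral 0 t F = mx_integral 0 t F'.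
Proof.
move=> FF; apply/matrixP => i j; rewrite !mxE.
by congr Complex; apply: eq_Rintegral => s /set_mem /=; rewrite in_itv /= => st;
  rewrite /entry_Re /entry_Im FF.
Qed.

(** Used to extract the factor that [iterated_integral] accumulates on the left. *)
Lemma mulmx_mx_integral (R : realType) (t : R) (p q r : nat)
    (P : 'M[R[i]]_(p, q)) (F : R -> 'M[R[i]]_(q, r)) :
  mx_bounded_measurable t F ->
  P *m mx_integral 0 t F = mx_integral 0 t (fun s => P *m F s).
Proof.
move=> bF.
have bc (c : R) f : bounded_measurable t f -> bounded_measurable t (fun s => c * f s).
  by move=> bf; exact: bounded_measurableM (bounded_measurable_cst t c) bf.
have intc (c : R) f : bounded_measurable t f ->
    \int[lebesgue_measure]_(s in `[0, t]) (c * f s) =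
    c * \int[lebesgue_measure]_(s in `[0, t]) f s.
  move=> bf; apply: RintegralZl => //.
  exact: (bounded_measurable_integrable (lexx t) bf).
have intcD (c d : R) f g : bounded_measurable t f -> bounded_measurable t g ->
    \int[lebesgue_measure]_(s in `[0, t]) (c * f s + d * g s) =
    c * \int[lebesgue_measure]_(s in `[0, t]) f s +
    d * \int[lebesgue_measure]_(s in `[0, t]) g s.
  move=> bf bg; rewrite -!intc // RintegralD //.
    exact: (bounded_measurable_integrable (lexx t) (bc _ _ bf)).
  exact: (bounded_measurable_integrable (lexx t) (bc _ _ bg)).
apply/matrixP => i k; rewrite !mxE entry_Re_mulmx entry_Im_mulmx.
apply/eqP; rewrite eq_complex complex_Re_sum complex_Im_sum /=.
apply/andP; split; apply/eqP.
  rewrite Rintegral_sum_seq => [|j]; last first.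
    have [bR bI] := bF j k; apply: bounded_measurableD; first exact: bc.
    by apply: bounded_measurableN; exact: bc.
  apply: eq_bigr => j _; have [bR bI] := bF j k.
  rewrite complex_ReM !mxE /= -mulNr -intcD //.
  by apply: eq_Rintegral => s _; rewrite mulNr.
rewrite Rintegral_sum_seq => [|j]; last first.
  by have [bR bI] := bF j k; apply: bounded_measurableD; exact: bc.
apply: eq_bigr => j _; have [bR bI] := bF j k.
by rewrite complex_ImM !mxE /= -intcD.
Qed.

(* Iterated integrals in the interaction picture, with an adjoint solution Y in
   place of the inverse of U and without the accumulated left factor. *)
Fixpoint dyson_integral (R : realType) (n : nat) (Y U : R -> 'M[R[i]]_n)
    (As : seq (R -> 'M[R[i]]_n)) (t : R) : 'M[R[i]]_n :=
  if As is A :: As' then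
    mx_integral 0 t (fun s => Y s *m A s *m U s *m dyson_integral Y U As' s)
  else 1%:M.

Lemma mx_continuous_on_cst (R : realType) (T : R) (p q : nat)
    (P : 'M[R[i]]_(p, q)) : mx_continuous_on T (fun=> P).
Proof.
by move=> i j; split; apply: continuous_subspaceT => x; exact: cst_continuous.
Qed.

Lemma dyson_integrand_bounded_measurable (R : realType) (T : R) (n : nat)
    (Y U A D : R -> 'M[R[i]]_n) :
  mx_continuous_on T Y -> mx_continuous_on T U -> mx_continuous_on T D ->
  mx_bounded_measurable T A ->
  mx_bounded_measurable T (fun s => Y s *m A s *m U s *m D s).
Proof.
move=> /mx_continuous_on_bounded_measurable bY.
move=> /mx_continuous_on_bounded_measurable bU.
move=> /mx_continuous_on_bounded_measurable bD bA.
exact: mx_bounded_measurable_mulmx (mx_bounded_measurable_mulmx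
  (mx_bounded_measurable_mulmx bY bA) bU) bD.
Qed.

(** Conditions on a list of generators are stated for all [k] through [nth] with the zero function
    as default: passing to the tail is a shift to [k.+1], and positions past the end are
    harmless. *)
Lemma dyson_integral_continuous (R : realType) (T : R) (n : nat)
    (Y U : R -> 'M[R[i]]_n) (As : seq (R -> 'M[R[i]]_n)) :
  0 < T -> mx_continuous_on T Y -> mx_continuous_on T U ->
  (forall k, mx_bounded_measurable T (nth (fun=> 0) As k)) ->
  mx_continuous_on T (dyson_integral Y U As).
Proof.
move=> T0 cY cU; elim: As => [_|A As IH bA] /=.
  exact: mx_continuous_on_cst.
have cD := IH (fun k => bA k.+1).
have bf := dyson_integrand_bounded_measurable cY cU cD (bA 0%N).
have [|//] := @mx_primitive R T n n 0 (dyson_integral Y U (A :: As)) _ T0 bf.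
by move=> t tT /=; rewrite add0r.
Qed.

(** The integrand is continuous at [t] as soon as [A] is: the other factors, inner integral
    included, are continuous on all of [[0, T]]. *)
Lemma dyson_integral_cons (R : realType) (T : R) (n : nat)
    (Y U : R -> 'M[R[i]]_n) (A : R -> 'M[R[i]]_n)
    (As : seq (R -> 'M[R[i]]_n)) :
  0 < T -> mx_continuous_on T Y -> mx_continuous_on T U ->
  (forall k, mx_bounded_measurable T (nth (fun=> 0) (A :: As) k)) ->
  dyson_integral Y U (A :: As) 0 = 0 /\
  forall t, 0 < t < T -> mx_continuous_at A t ->
    mx_is_derive (dyson_integral Y U (A :: As)) t
      (Y t *m A t *m U t *m dyson_integral Y U As t).
Proof.
move=> T0 cY cU bA.
have cD := dyson_integral_continuous T0 cY cU (fun k => bA k.+1).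
have bf := dyson_integrand_bounded_measurable cY cU cD (bA 0%N).
have [|_ D0 dD] := @mx_primitive R T n n 0 (dyson_integral Y U (A :: As)) _ T0 bf.
  by move=> t tT /=; rewrite add0r.
split=> // t tT cA; apply: dD => //.
apply: mx_continuous_at_mulmx (mx_continuous_on_at cD tT).
apply: mx_continuous_at_mulmx (mx_continuous_on_at cU tT).
exact: mx_continuous_at_mulmx (mx_continuous_on_at cY tT) cA.
Qed.

(** In [iterated_integral] the inner integrals depend on the outer variables through [P]. Once [P]
    is factored out, each is a function of its upper limit alone, to which the fundamental theorem
    of calculus applies. The induction is over all [P], which grows at each level. *)
Lemma iterated_integral_dyson (R : realType) (T : R) (n : nat)
    (Y U : R -> 'M[R[i]]_n) (As : seq (R -> 'M[R[i]]_n)) (P : 'M[R[i]]_n)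
    (t : R) :
  0 < T -> mx_continuous_on T Y -> mx_continuous_on T U ->
  (forall s, 0 <= s <= T -> Y s *m U s = 1%:M) ->
  (forall k, mx_bounded_measurable T (nth (fun=> 0) As k)) ->
  0 <= t <= T ->
  iterated_integral P [seq (fun s => invmx (U s) *m A s *m U s) | A <- As] t =
  P *m dyson_integral Y U As t.
Proof.
move=> T0 cY cU YU; elim: As P t => [|A As IH] P t bA /andP[t0 tT] /=.
  by rewrite mulmx1.
have cD := dyson_integral_continuous T0 cY cU (fun k => bA k.+1).
have bf := dyson_integrand_bounded_measurable cY cU cD (bA 0%N).
rewrite mulmx_mx_integral; last first.
  have sub f : bounded_measurable T f -> bounded_measurable t f.
    move=> [mf [M fM]]; split.
      apply: measurable_funS mf => // x /=.
      by rewrite !in_itv /= => /andP[->] /le_trans; exact.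
    by exists M => x /andP[x0 xt]; apply: fM; rewrite x0 (le_trans xt).
  by move=> i j; have [bR bI] := bf i j; split; exact: sub.
apply: eq_mx_integral => s /andP[s0 st].
have sT : 0 <= s <= T by rewrite s0 (le_trans st).
rewrite IH //; last by move=> k; exact: bA k.+1.
have [_ uU] := mulmx1_unit (YU s sT).
have -> : invmx (U s) = Y s by rewrite -[LHS]mul1mx -(YU s sT) mulmxK.
by rewrite !mulmxA.
Qed.

(** * The bidiagonal generator *)

Lemma piecewise_continuous_cst (R : realType) (T c : R) :
  piecewise_continuous T (fun=> c).
Proof.
exists [::]; split=> t _ *; first exact: cst_continuous.
  exact: is_cvg_cst.
exact: is_cvg_cst.
Qed.

Lemma mx_piecewise_continuous_cst (R : realType) (T : R) (p q : nat)
    (P : 'M[R[i]]_(p, q)) : mx_piecewise_continuous T (fun=> P).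
Proof.
by move=> i j; split;
  [exact: (piecewise_continuous_cst T (complex.Re (P i j)))
  |exact: (piecewise_continuous_cst T (complex.Im (P i j)))].
Qed.

Lemma mx_piecewise_continuous_nth (R : realType) (T : R) (n m : nat)
    (A : m.-tuple (R -> 'M[R[i]]_n)) :
  (forall k : 'I_m, mx_piecewise_continuous T (tnth A k)) ->
  forall k, mx_piecewise_continuous T (nth (fun=> 0) A k).
Proof.
move=> pA k; have [km|mk] := ltnP k m.
  by have := pA (Ordinal km); rewrite (tnth_nth (fun=> 0)).
by rewrite nth_default ?size_tuple //; exact: mx_piecewise_continuous_cst.
Qed.

Lemma entry_Re_mxblock (R : realType) (n m : nat)
    (B : R -> 'I_m.+1 -> 'I_m.+1 -> 'M[R[i]]_n) a b :
  entry_Re (fun t => \mxblock_(i, j) B t i j) a b =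
  entry_Re (fun t => B t (tagnat.sig1 a) (tagnat.sig1 b))
    (tagnat.sig2 a) (tagnat.sig2 b).
Proof. by apply/funext => t; rewrite /entry_Re mxE. Qed.

Lemma entry_Im_mxblock (R : realType) (n m : nat)
    (B : R -> 'I_m.+1 -> 'I_m.+1 -> 'M[R[i]]_n) a b :
  entry_Im (fun t => \mxblock_(i, j) B t i j) a b =
  entry_Im (fun t => B t (tagnat.sig1 a) (tagnat.sig1 b))
    (tagnat.sig2 a) (tagnat.sig2 b).
Proof. by apply/funext => t; rewrite /entry_Im mxE. Qed.

Lemma entrywise_mxblock (R : realType) (C : (R -> R) -> Prop) (n m : nat)
    (B : R -> 'I_m.+1 -> 'I_m.+1 -> 'M[R[i]]_n) :
  (forall i j, entrywise C (fun t => B t i j)) ->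
  entrywise C (fun t => \mxblock_(i, j) B t i j).
Proof.
move=> CB a b; rewrite entry_Re_mxblock entry_Im_mxblock; exact: CB.
Qed.

Lemma mx_piecewise_continuous_bidiagonal (R : realType) (T : R) (n m : nat)
    (G : R -> 'M[R[i]]_n) (A : m.-tuple (R -> 'M[R[i]]_n)) :
  mx_piecewise_continuous T G ->
  (forall k, mx_piecewise_continuous T (nth (fun=> 0) A k)) ->
  mx_piecewise_continuous T (bidiagonal_generator G A).
Proof.
move=> pG pA; apply: (@entrywise_mxblock _ (piecewise_continuous T)) => i j.
case: eqP => [_|_]; first exact: pG.
case: eqP => _; first exact: pA.
by apply: mx_piecewise_continuous_cst.
Qed.

Lemma mx_continuous_at_submxblock (R : realType) (n m : nat)
    (L : R -> 'M[R[i]]_(\sum_(k < m.+1) n)) (t : R) (i j : 'I_m.+1) :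
  mx_continuous_at L t -> mx_continuous_at (fun s => submxblock (L s) i j) t.
Proof.
move=> cL k l.
have -> : entry_Re (fun s => submxblock (L s) i j) k l =
    entry_Re L (tagnat.Rank i k) (tagnat.Rank j l).
  by apply/funext => s; rewrite /entry_Re mxE.
have -> : entry_Im (fun s => submxblock (L s) i j) k l =
    entry_Im L (tagnat.Rank i k) (tagnat.Rank j l).
  by apply/funext => s; rewrite /entry_Im mxE.
exact: cL.
Qed.

(** [G] is block [(0, 0)] and entry [k] of [A] is block [(k, k.+1)], so continuity of the whole
    matrix restricts to them. *)
Lemma mx_continuous_at_bidiagonal (R : realType) (n m : nat)
    (G : R -> 'M[R[i]]_n) (A : m.-tuple (R -> 'M[R[i]]_n)) (t : R) :
  mx_continuous_at (bidiagonal_generator G A) t ->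
  mx_continuous_at G t /\
  forall k, (k < m)%N -> mx_continuous_at (nth (fun=> 0) A k) t.
Proof.
move=> cL; split=> [|k km].
  have := mx_continuous_at_submxblock ord0 ord0 cL.
  by under eq_fun do rewrite mxblockK eqxx.
have km1 : (k < m.+1)%N by exact: ltnW.
have := @mx_continuous_at_submxblock _ _ _ _ _
  (Ordinal km1) (@Ordinal m.+1 k.+1 km) cL.
under eq_fun do rewrite mxblockK -val_eqE /= ltn_eqF // eqxx.
exact.
Qed.

(* Block (i, j) of the time-ordered exponential of the bidiagonal generator. *)
Definition bidiagonal_block (R : realType) (n : nat) (Y U : R -> 'M[R[i]]_n)
    (As : seq (R -> 'M[R[i]]_n)) (i j : nat) (t : R) : 'M[R[i]]_n :=
  if (j < i)%N then 0
  else U t *m dyson_integral Y U (take (j - i) (drop i As)) t.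

Lemma nth_take_drop_bounded_measurable (R : realType) (T : R) (n : nat)
    (As : seq (R -> 'M[R[i]]_n)) (a b : nat) :
  (forall k, mx_bounded_measurable T (nth (fun=> 0) As k)) ->
  forall k, mx_bounded_measurable T (nth (fun=> 0) (take a (drop b As)) k).
Proof.
move=> bA k; have [ka|ak] := ltnP k a.
  by rewrite nth_take // nth_drop.
have -> : nth (fun=> 0) (take a (drop b As)) k = fun=> 0.
  by apply: nth_default; rewrite (leq_trans _ ak) // size_take_min geq_minl.
by apply: mx_continuous_on_bounded_measurable; exact: mx_continuous_on_cst.
Qed.

Lemma bidiagonal_block_continuous (R : realType) (T : R) (n : nat)
    (Y U : R -> 'M[R[i]]_n) (As : seq (R -> 'M[R[i]]_n)) (i j : nat) :
  0 < T -> mx_continuous_on T Y -> mx_continuous_on T U ->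
  (forall k, mx_bounded_measurable T (nth (fun=> 0) As k)) ->
  mx_continuous_on T (bidiagonal_block Y U As i j).
Proof.
move=> T0 cY cU bA; rewrite /bidiagonal_block.
case: (j < i)%N; first exact: mx_continuous_on_cst.
apply: mx_continuous_on_mulmx => //; apply: dyson_integral_continuous => //.
exact: nth_take_drop_bounded_measurable.
Qed.

(** Above the diagonal, with [D] the iterated integral and [D'] that of the tail, the product rule
    gives [G U D + U (Y A_i U D')], and [U Y = 1] cancels. On the diagonal the block is [U], and
    block [(i.+1, i)] vanishes. *)
Lemma bidiagonal_block_is_derive (R : realType) (T : R) (n : nat)
    (G Y U : R -> 'M[R[i]]_n) (As : seq (R -> 'M[R[i]]_n)) (i j : nat) :
  0 < T -> mx_continuous_on T Y -> mx_continuous_on T U ->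
  (forall s, 0 <= s <= T -> Y s *m U s = 1%:M) ->
  (forall k, mx_bounded_measurable T (nth (fun=> 0) As k)) ->
  (j <= size As)%N ->
  forall t, 0 < t < T -> mx_is_derive U t (G t *m U t) ->
  (forall k, (k < size As)%N -> mx_continuous_at (nth (fun=> 0) As k) t) ->
  mx_is_derive (bidiagonal_block Y U As i j) t
    (G t *m bidiagonal_block Y U As i j t +
     nth (fun=> 0) As i t *m bidiagonal_block Y U As i.+1 j t).
Proof.
move=> T0 cY cU YU bA jm t tT dU cA; rewrite /bidiagonal_block.
have [ji|ij] := ltnP j i.
  rewrite (ltnW ji : (j < i.+1)%N) !mulmx0 addr0 => k l.
  by rewrite mxE; split; exact: is_derive_cst.
rewrite ltnS; move: ij; rewrite leq_eqVlt => /predU1P[<-|ij].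
  rewrite leqnn subnn take0 /= mulmx0 addr0 mulmx1.
  by under eq_fun do rewrite mulmx1.
rewrite leqNgt ij /=.
have im : (i < size As)%N by exact: leq_trans jm.
have bB := nth_take_drop_bounded_measurable (j - i) i bA.
(* Exposes entry [i] as the head of the list; the tail is the list of block [(i.+1, j)]. *)
move: bB; rewrite (drop_nth (fun=> 0) im) -(subnSK ij) take_cons => bB.
have [_ dD] := dyson_integral_cons T0 cY cU bB.
have := mx_is_derive_mulmx dU (dD t tT (cA i im)).
rewrite !mulmxA (mulmx1C (YU t _)) ?mul1mx -?mulmxA //.
by case/andP: tT => t0 tT; rewrite !ltW.
Qed.

Lemma bidiagonal_solution (R : realType) (T : R) (n m : nat)
    (G Y U : R -> 'M[R[i]]_n) (A : m.-tuple (R -> 'M[R[i]]_n)) :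
  0 < T -> mx_continuous_on T Y ->
  (forall s, 0 <= s <= T -> Y s *m U s = 1%:M) ->
  is_ivp_solution T G U ->
  (forall k, mx_piecewise_continuous T (nth (fun=> 0) A k)) ->
  is_ivp_solution T (bidiagonal_generator G A)
    (fun t => \mxblock_(i < m.+1, j < m.+1) bidiagonal_block Y U A i j t).
Proof.
move=> T0 cY YU [cU U0 dU] pA.
have bA k : mx_bounded_measurable T (nth (fun=> 0) A k).
  exact: mx_piecewise_continuous_bounded_measurable.
split.
- apply: (@entrywise_mxblock _ (fun f => {within `[0, T], continuous f})) => i j.
  exact: bidiagonal_block_continuous.
- rewrite -mxdiagZ; apply/eq_mxblockP => i j; rewrite /bidiagonal_block.
  case: eqVneq => [<-|ij].
    by rewrite conform_mx_id ltnn subnn take0 U0 mulmx1.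
  (* Above the diagonal the list is nonempty, so the outermost integral runs over [[0, 0]] and
     vanishes. *)
  case: ltnP => // ji; have {}ij : (i < j)%N by rewrite ltn_neqAle ij.
  have im : (i < size A)%N.
    by rewrite size_tuple; apply: leq_trans ij _; rewrite -ltnS.
  have := nth_take_drop_bounded_measurable (j - i) i bA.
  rewrite (drop_nth (fun=> 0) im) -(subnSK ij) take_cons => bB.
  by have [-> _] := dyson_integral_cons T0 cY cU bB; rewrite mulmx0.
move=> t tT cL; have [cG cA] := mx_continuous_at_bidiagonal cL.
have -> : bidiagonal_generator G A t *m
    \mxblock_(i < m.+1, j < m.+1) bidiagonal_block Y U A i j t =
  \mxblock_(i < m.+1, j < m.+1) (G t *m bidiagonal_block Y U A i j t +
     nth (fun=> 0) A i t *m bidiagonal_block Y U A i.+1 j t).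
  (* Row [i] of the generator has at most two nonzero blocks, in columns [i] and [i.+1]; they are
     split off the sum in turn. *)
  rewrite mul_mxblock; apply/eq_mxblockP => i j.
  rewrite (bigD1 i) //= eqxx; congr (_ + _).
  have [im|mi] := ltnP i m.
    pose i1 := @Ordinal m.+1 i.+1 im.
    rewrite (bigD1 i1) /=; last by rewrite -val_eqE /= gtn_eqF.
    rewrite -val_eqE /= ltn_eqF // eqxx big1 ?addr0 // => k /andP[ki ki1].
    rewrite eq_sym (negbTE ki) ifF ?mul0mx //.
    by apply/negbTE; rewrite -[i.+1]/(val i1) val_eqE.
  (* In the last row there is no column [i.+1]; the default value [0] of [nth] makes the second term
     vanish accordingly. *)
  rewrite nth_default ?size_tuple // mul0mx big1 // => k ki.
  rewrite eq_sym (negbTE ki) ifF ?mul0mx //.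
  by apply: ltn_eqF; rewrite (leq_trans (ltn_ord k)).
move=> a b; rewrite entry_Re_mxblock entry_Im_mxblock mxE.
apply: (bidiagonal_block_is_derive _ T0 cY cU YU bA _ tT).
- by rewrite size_tuple -ltnS.
- exact: dU.
- by move=> k; rewrite size_tuple; exact: cA.
Qed.

(* take (j - i) (drop i A) lists the entries of A with index k, i <= k < j. *)
Theorem mainTheorem2 (R : realType) (T : R) (n m : nat)
    (G : R -> 'M[R[i]]_n) (A : m.-tuple (R -> 'M[R[i]]_n)) :
  0 < T -> (0 < n)%N -> (0 < m)%N ->
  mx_piecewise_continuous T G ->
  (forall k : 'I_m, mx_piecewise_continuous T (tnth A k)) ->
  let U := time_ordered_exp T G in
  let V := time_ordered_exp T (bidiagonal_generator G A) in
  forall t : R, 0 <= t <= T ->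
  [/\ forall i j : 'I_m.+1, (j < i)%N -> submxblock (V t) i j = 0,
      forall i : 'I_m.+1, submxblock (V t) i i = U t,
      forall i j : 'I_m.+1, (i < j)%N ->
        submxblock (V t) i j = DU U (take (j - i) (drop i A)) t
    & submxblock (V t) ord0 ord_max = DU U A t].
Proof.
move=> T0 _ m0 pG /mx_piecewise_continuous_nth pA U V t tT.
have sU : is_ivp_solution T G U by exact: time_ordered_exp_solution.
have pL := mx_piecewise_continuous_bidiagonal pG pA.
have sV := time_ordered_exp_solution T0 pL.
have [Y sY] := adjoint_solution_exists T0 pG.
have YU := adjoint_solution_mulmx pG sY sU.
have [cY _ _] := sY; have [cU _ _] := sU.
have bA k := mx_piecewise_continuous_bounded_measurable T0 (pA k).
have VE i j : submxblock (V t) i j = bidiagonal_block Y U A i j t.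
  rewrite /V (ivp_solution_unique T0 pL sV (bidiagonal_solution T0 cY YU sU pA) tT).
  by rewrite mxblockK.
have VDU (i j : 'I_m.+1) : (i < j)%N ->
    submxblock (V t) i j = DU U (take (j - i) (drop i A)) t.
  move=> ij; rewrite VE /bidiagonal_block ltnNge (ltnW ij) /= /DU.
  rewrite (iterated_integral_dyson 1%:M T0 cY cU YU _ tT) ?mul1mx //.
  exact: nth_take_drop_bounded_measurable.
split=> [i j ji|i|//|].
- by rewrite VE /bidiagonal_block ji.
- by rewrite VE /bidiagonal_block ltnn subnn take0 mulmx1.
(* The corner lies off the diagonal because [0 < m], and its list is the whole tuple. *)
- by rewrite VDU //= subn0 drop0 take_oversize // size_tuple.
Qed.
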